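(* The functions $\hat y_1,\hat y_2$ satisfy $$\lim_{c\to0}\hat y_1(c)=\lim_{c\to 0}\hat y_2(c)=\Psi\left(\frac{1}{2\delta}\right).$$
   Context: Fix $\alpha>0$, $\delta>0$ and $0<\lambda<\alpha\delta$. Let $f_0=\frac{1}{\sqrt{2\alpha}}\left(\sqrt{\frac{\alpha\delta+\lambda}{\alpha\delta-\lambda}}-1\right)>0$, the unique positive root of $\rho(x)=x^2+\frac{2x}{\sqrt{2\alpha}}-\frac{\lambda/\alpha}{\alpha\delta-\lambda}$. Standing assumption: $f_0>\frac{\alpha}{2\lambda}$ (equivalently $\lambda\in(\lambda^\dagger,\alpha\delta)$, where $\lambda^\dagger$ is the unique value of $\lambda$ at which $f_0=\frac{\alpha}{2\lambda}$), so that $\frac{1}{2\delta}<\frac{\alpha}{2\lambda}<f_0$. Let $B_0=-\frac{2f_0}{\alpha\sqrt{2\alpha}}(\alpha\delta-\lambda)e^{f_0\sqrt{2\alpha}}$ and $\Psi(x)=e^{2\sqrt{2\alpha}\,x}$. For $x\ge 0$, $c>0$ put $h_l(x)=\left(\delta-\frac{\lambda}{\alpha}\right)x^2-\frac{\lambda}{\alpha^2}$, $h_{r1}(x;c)=\delta c(c-2x)+\left(\delta-\frac{\lambda}{\alpha}\right)x^2+c-\frac{\lambda}{\alpha^2}$, $h_{r2}(x;c)=\frac{\lambda}{\alpha}c(c-2x)+c+B_0e^{-(x-c)\sqrt{2\alpha}}$, $h_r(x;c)=h_{r1}(x;c)$ for $x\in[0,f_0+c]$, $h_r(x;c)=h_{r2}(x;c)$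 for $x\ge f_0+c$, and $h=\min\{h_l,h_r\}$. For $y\ge1$ and $x=\Psi^{-1}(y)$ let $H_l(y)=e^{\sqrt{2\alpha}\,x}h_l(x)$, $H_r(y;c)=e^{\sqrt{2\alpha}\,x}h_r(x;c)$, $H(y;c)=e^{\sqrt{2\alpha}\,x}h(x;c)$. Put $y_c=\Psi\left(\frac1{2\delta}+\frac c2\right)$ and let $y_v(c)\in[y_c,\Psi(f_0+c))$ be the unique point such that $H_r(\cdot;c)$ is strictly convex on $(y_v(c),\infty)$ and strictly concave on $(y_c,y_v(c))$ (if $y_v(c)>y_c$). Let $c_1>0$ be a fixed constant (one exists) such that for every $c\in(0,c_1)$ there is a unique couple $(\hat y_1(c),\hat y_2(c))$ with $1<\hat y_1(c)<y_c\le y_v(c)<\hat y_2(c)$ solving $\frac{\partial H_l}{\partial y}(y_1)=\frac{\partial H_r}{\partial y}(y_2;c)$ and $H_l(y_1)-\frac{\partial H_l}{\partial y}(y_1)y_1=H_r(y_2;c)-\frac{\partial H_r}{\partial y}(y_2;c)y_2$; moreover $\hat y_1(c)<\Psi(f_0)$, and the function equal to $H_l$ on $[1,\hat y_1(c)]$, to the common tangent line $A(c)y+B(c)$ (with $A(c)=\frac{\partial H_l}{\partial y}(\hat y_1(c))$, $B(c)=H_l(\hat y_1(c))-A(c)\hat y_1(c)$) on $(\hat y_1(c),\hat y_2(c))$ and to $H_r(\cdot;c)$ on $[\hat y_2(c),\infty)$ is the greatest nonpositive convex minorant of $H(\cdot;c)$ on $[1,\infty)$. The common tangent line lies below $H(\cdot;c)$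 on $(1,\infty)$. This defines $\hat y_1,\hat y_2:(0,c_1)\to(1,\infty)$. *)

(* Defs.v *)
From Stdlib Require Import Reals Lra.
From Coquelicot Require Import Coquelicot.
Open Scope R_scope.

Definition strictly_convex_on (D : R -> Prop) (f : R -> R) : Prop :=
  forall x y t, D x -> D y -> x <> y -> 0 < t < 1 ->
    f (t * x + (1 - t) * y) < t * f x + (1 - t) * f y.

Definition strictly_concave_on (D : R -> Prop) (f : R -> R) : Prop :=
  strictly_convex_on D (fun x => - f x).

Definition convex_on (D : R -> Prop) (f : R -> R) : Prop :=
  forall x y t, D x -> D y -> 0 <= t <= 1 ->
    f (t * x + (1 - t) * y) <= t * f x + (1 - t) * f y.

Definition nonpos_convex_minorant (D : R -> Prop) (H W : R -> R) : Prop :=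
  convex_on D W /\ (forall y, D y -> W y <= 0) /\ (forall y, D y -> W y <= H y).

Definition greatest_nonpos_convex_minorant
    (D : R -> Prop) (H W : R -> R) : Prop :=
  nonpos_convex_minorant D H W /\
  forall V, nonpos_convex_minorant D H V -> forall y, D y -> V y <= W y.

Definition f0 (alpha delta lambda : R) : R :=
  / sqrt (2 * alpha) *
  (sqrt ((alpha * delta + lambda) / (alpha * delta - lambda)) - 1).

Definition B0 (alpha delta lambda : R) : R :=
  - (2 * f0 alpha delta lambda / (alpha * sqrt (2 * alpha)))
  * (alpha * delta - lambda)
  * exp (f0 alpha delta lambda * sqrt (2 * alpha)).

Definition Psi (alpha x : R) : R := exp (2 * sqrt (2 * alpha) * x).

Definition Psi_inv (alpha y : R) : R := ln y / (2 * sqrt (2 * alpha)).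

Lemma Psi_inv_Psi (alpha x : R) : 0 < alpha -> Psi_inv alpha (Psi alpha x) = x.
Proof.
intros Ha; unfold Psi_inv, Psi; rewrite ln_exp; field.
apply Rgt_not_eq, sqrt_lt_R0; lra.
Qed.

Lemma Psi_Psi_inv (alpha y : R) :
  0 < alpha -> 0 < y -> Psi alpha (Psi_inv alpha y) = y.
Proof.
intros Ha Hy; unfold Psi_inv, Psi.
replace (2 * sqrt (2 * alpha) * (ln y / (2 * sqrt (2 * alpha)))) with (ln y).
- now apply exp_ln.
- field; apply Rgt_not_eq, sqrt_lt_R0; lra.
Qed.

Definition h_l (alpha delta lambda x : R) : R :=
  (delta - lambda / alpha) * x ^ 2 - lambda / alpha ^ 2.

Definition h_r1 (alpha delta lambda x c : R) : R :=
  delta * c * (c - 2 * x) + (delta - lambda / alpha) * x ^ 2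
  + c - lambda / alpha ^ 2.

Definition h_r2 (alpha delta lambda x c : R) : R :=
  lambda / alpha * c * (c - 2 * x) + c
  + B0 alpha delta lambda * exp (- (x - c) * sqrt (2 * alpha)).

(* The two branches agree to first order at x = f0 + c: the values because
   f0 is a root of rho, the derivatives by the choice of B0. *)
Definition h_r (alpha delta lambda x c : R) : R :=
  if Rle_dec x (f0 alpha delta lambda + c)
  then h_r1 alpha delta lambda x c else h_r2 alpha delta lambda x c.

Definition h (alpha delta lambda x c : R) : R :=
  Rmin (h_l alpha delta lambda x) (h_r alpha delta lambda x c).

(* H_l, H_r and H are meant for y >= 1 only, i.e. Psi_inv alpha y >= 0. *)
Definition H_l (alpha delta lambda y : R) : R :=
  let x := Psi_inv alpha y in
  exp (sqrt (2 * alpha) * x) * h_l alpha delta lambda x.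

Definition H_r (alpha delta lambda y c : R) : R :=
  let x := Psi_inv alpha y in
  exp (sqrt (2 * alpha) * x) * h_r alpha delta lambda x c.

Definition H (alpha delta lambda y c : R) : R :=
  let x := Psi_inv alpha y in
  exp (sqrt (2 * alpha) * x) * h alpha delta lambda x c.

Definition dH_l (alpha delta lambda y : R) : R :=
  Derive (fun z => H_l alpha delta lambda z) y.

Definition dH_r (alpha delta lambda y c : R) : R :=
  Derive (fun z => H_r alpha delta lambda z c) y.

Definition y_c (alpha delta c : R) : R := Psi alpha (1 / (2 * delta) + c / 2).

(* At most one yv satisfies this; the concavity clause is vacuous when
   yv = y_c alpha delta c. *)
Definition is_y_v (alpha delta lambda c yv : R) : Prop :=
  y_c alpha delta c <= yv < Psi alpha (f0 alpha delta lambda + c) /\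
  strictly_convex_on (fun y => yv < y) (fun y => H_r alpha delta lambda y c) /\
  strictly_concave_on (fun y => y_c alpha delta c < y < yv)
    (fun y => H_r alpha delta lambda y c).

Definition tangency_couple (alpha delta lambda yv c y1 y2 : R) : Prop :=
  1 < y1 /\ y1 < y_c alpha delta c /\ y_c alpha delta c <= yv /\ yv < y2 /\
  dH_l alpha delta lambda y1 = dH_r alpha delta lambda y2 c /\
  H_l alpha delta lambda y1 - dH_l alpha delta lambda y1 * y1
  = H_r alpha delta lambda y2 c - dH_r alpha delta lambda y2 c * y2.

Definition tangent_line (alpha delta lambda y1 y : R) : R :=
  let A := dH_l alpha delta lambda y1 in
  let B := H_l alpha delta lambda y1 - A * y1 in
  A * y + B.

Definition glued (alpha delta lambda c y1 y2 y : R) : R :=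
  if Rle_dec y y1 then H_l alpha delta lambda y
  else if Rlt_dec y y2 then tangent_line alpha delta lambda y1 y
  else H_r alpha delta lambda y c.

Definition admissible_c1 (alpha delta lambda : R) (y_v : R -> R) (c1 : R) : Prop :=
  0 < c1 /\
  forall c, 0 < c < c1 ->
    (exists! p : R * R,
        tangency_couple alpha delta lambda (y_v c) c (fst p) (snd p)) /\
    forall y1 y2, tangency_couple alpha delta lambda (y_v c) c y1 y2 ->
      y1 < Psi alpha (f0 alpha delta lambda) /\
      greatest_nonpos_convex_minorant (fun y => 1 <= y)
        (fun y => H alpha delta lambda y c)
        (glued alpha delta lambda c y1 y2) /\
      (forall y, 1 < y ->
         tangent_line alpha delta lambda y1 y <= H alpha delta lambda y c).

(* Main.v *)
Require Import Defs.
From Stdlib Require Import Reals Lra.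
From Coquelicot Require Import Coquelicot.
Open Scope R_scope.

(** The equality of slopes at the two tangency points forces them together.
    Write [s = sqrt (2 alpha)] and [x = Psi_inv y].  In the variable [x], the
    [y]-derivative of [exp (s x) * h x] is [exp (- s x) * (h' x + s * h x)] up
    to the constant factor [2 s] ([is_derive_lift]).  Let [G] be this quantity
    for [h_l].  Then [G' x = 2 exp (- s x) (delta - (alpha delta - lambda) x^2)],
    which is bounded below by some [m > 0] for [0 <= x <= f0 + 1/s] because [f0]
    is a root of [rho] ([slope_l_growth]); for the same reason [G f0 = 0].

    Let [x1], [x2] be the abscissae of the tangency points, so that
    [x1 < 1/(2 delta) + c/2 < x2].  The slope of [H_r] differs from that of its
    limit as [c] tends to 0 (which is [G] below [f0 + c] and 0 beyond) by a
    term that is at least [- K c] uniformly in [x] ([exp_weight_bound]).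

    If [x2 > f0 + c], equality of slopes gives [G x1 >= - K c], whereas
    [G x1 <= - m (f0 - x1)] and [f0 - x1] is bounded away from 0, as
    [1/(2 delta) < f0]; so this does not happen for small [c].  If
    [x2 <= f0 + c], then [m (x2 - x1) <= G x2 - G x1 <= K c], and both
    abscissae are within [O(c)] of [1/(2 delta)] ([abscissae_close]). *)

(** * Derivatives in the variable x *)

(** Numerator of the [y]-slope at abscissa [x] of [exp (s x) * h x], when [h]
    has value [v] and derivative [l] at [x]. *)
Definition lift_slope (s x v l : R) : R := exp (- (s * x)) * (l + s * v).

(** The exponent changes sign because [y = exp (2 s x)], so that
    [dx/dy = exp (- 2 s x) / (2 s)]. *)
Lemma is_derive_lift (alpha y l : R) (h : R -> R) :
  0 < alpha -> 0 < y -> is_derive h (Psi_inv alpha y) l ->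
  is_derive (fun z => exp (sqrt (2 * alpha) * Psi_inv alpha z)
                      * h (Psi_inv alpha z)) y
    (lift_slope (sqrt (2 * alpha)) (Psi_inv alpha y) (h (Psi_inv alpha y)) l
     / (2 * sqrt (2 * alpha))).
Proof.
intros Ha Hy Hh.
assert (Hs : 0 < sqrt (2 * alpha)) by (apply sqrt_lt_R0; lra).
set (s := sqrt (2 * alpha)) in *.
set (x := Psi_inv alpha y) in *.
assert (HP : is_derive (Psi_inv alpha) y (/ (2 * s * y))).
{ unfold Psi_inv; fold s; auto_derive; [exact Hy | field; lra]. }
assert (HF : is_derive (fun x => exp (s * x) * h x) x
               (s * exp (s * x) * h x + exp (s * x) * l)).
{ auto_derive; [now exists l |].
  replace (Derive (fun x => h x) x) with l by (symmetry; now apply is_derive_unique).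
  ring. }
evar_last.
{ exact (is_derive_comp (fun x => exp (s * x) * h x) (Psi_inv alpha) y _ _ HF HP). }
unfold lift_slope; simpl; unfold scal; simpl; unfold mult; simpl.
assert (Hyx : y = exp (s * x) * exp (s * x)).
{ rewrite <- (Psi_Psi_inv alpha y Ha Hy); fold x.
  rewrite <- exp_plus; unfold Psi; fold s; f_equal; ring. }
rewrite Hyx, exp_Ropp.
assert (He := exp_pos (s * x)).
field; lra.
Qed.

Lemma is_derive_glue (P : R -> Prop) (dec : forall z, {P z} + {~ P z})
  (f g : R -> R) (x l : R) :
  f x = g x -> is_derive f x l -> is_derive g x l ->
  is_derive (fun z => if dec z then f z else g z) x l.
Proof.
intros Efg Hf Hg.
apply is_derive_Reals in Hf; apply is_derive_Reals in Hg; apply is_derive_Reals.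
intros eps He.
destruct (Hf eps He) as [d1 H1]; destruct (Hg eps He) as [d2 H2].
exists (mkposreal _ (Rmin_pos _ _ (cond_pos d1) (cond_pos d2))); simpl.
intros t Ht0 Ht.
assert (Ht1 := Rlt_le_trans _ _ _ Ht (Rmin_l d1 d2)).
assert (Ht2 := Rlt_le_trans _ _ _ Ht (Rmin_r d1 d2)).
specialize (H1 t Ht0 Ht1); specialize (H2 t Ht0 Ht2).
destruct (dec (x + t)); destruct (dec x); congruence || (rewrite ?Efg in *; auto).
Qed.

Lemma is_derive_h_l (alpha delta lambda x : R) :
  is_derive (h_l alpha delta lambda) x (2 * (delta - lambda / alpha) * x).
Proof. unfold h_l; auto_derive; [easy | unfold Rdiv; ring]. Qed.

Lemma is_derive_h_r1 (alpha delta lambda x c : R) :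
  is_derive (fun z => h_r1 alpha delta lambda z c) x
    (2 * (delta - lambda / alpha) * x - 2 * delta * c).
Proof. unfold h_r1; auto_derive; [easy | unfold Rdiv; ring]. Qed.

Lemma is_derive_h_r2 (alpha delta lambda x c : R) :
  is_derive (fun z => h_r2 alpha delta lambda z c) x
    (- (2 * (lambda / alpha) * c)
     - sqrt (2 * alpha)
       * (B0 alpha delta lambda * exp (- (x - c) * sqrt (2 * alpha)))).
Proof. unfold h_r2; auto_derive; [easy | unfold Rdiv, Rminus; ring]. Qed.

(** * The free boundary f0 *)

(** The equation [rho f0 = 0], multiplied by [delta - lambda / alpha]. *)
Lemma f0_root (alpha delta lambda : R) :
  0 < alpha -> 0 < lambda < alpha * delta ->
  (delta - lambda / alpha) * f0 alpha delta lambda ^ 2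
  + 2 * (delta - lambda / alpha) * f0 alpha delta lambda / sqrt (2 * alpha)
  = lambda / alpha ^ 2.
Proof.
intros Ha Hl.
assert (Hs : 0 < sqrt (2 * alpha)) by (apply sqrt_lt_R0; lra).
assert (Hss : sqrt (2 * alpha) ^ 2 = 2 * alpha) by (apply pow2_sqrt; lra).
unfold f0.
set (q := (alpha * delta + lambda) / (alpha * delta - lambda)).
assert (Hq : 0 <= q) by (apply Rlt_le, Rdiv_lt_0_compat; lra).
assert (Hr := pow2_sqrt q Hq).
set (s := sqrt (2 * alpha)) in *; set (r := sqrt q) in *.
transitivity ((delta - lambda / alpha) * (r ^ 2 - 1) / s ^ 2).
- field; lra.
- rewrite Hss, Hr; unfold q; field; lra.
Qed.

Lemma B0_exp (alpha delta lambda : R) :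
  0 < alpha ->
  B0 alpha delta lambda * exp (- f0 alpha delta lambda * sqrt (2 * alpha))
  = - (2 * (delta - lambda / alpha) * f0 alpha delta lambda / sqrt (2 * alpha)).
Proof.
intros Ha.
assert (Hs : 0 < sqrt (2 * alpha)) by (apply sqrt_lt_R0; lra).
unfold B0; set (f := f0 alpha delta lambda); set (s := sqrt (2 * alpha)) in *.
replace (- f * s) with (- (f * s)) by ring.
rewrite exp_Ropp; assert (He := exp_pos (f * s)).
field; lra.
Qed.

Lemma inv_2delta_lt_f0 (alpha delta lambda : R) :
  0 < alpha -> 0 < lambda < alpha * delta ->
  f0 alpha delta lambda > alpha / (2 * lambda) ->
  1 / (2 * delta) < f0 alpha delta lambda.
Proof.
intros Ha Hl Hf.
assert (Hd : 0 < delta) by (apply Rmult_lt_reg_l with alpha; lra).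
apply Rlt_trans with (2 := Hf).
apply Rmult_lt_reg_r with (2 * delta * lambda); [nra |].
replace (1 / (2 * delta) * (2 * delta * lambda)) with lambda by (field; lra).
replace (alpha / (2 * lambda) * (2 * delta * lambda)) with (alpha * delta)
  by (field; lra).
lra.
Qed.

(** * Slopes of the two branches *)

Definition slope_l (alpha delta lambda x : R) : R :=
  lift_slope (sqrt (2 * alpha)) x (h_l alpha delta lambda x)
    (2 * (delta - lambda / alpha) * x).

Lemma dH_l_slope (alpha delta lambda y : R) :
  0 < alpha -> 0 < y ->
  dH_l alpha delta lambda y
  = slope_l alpha delta lambda (Psi_inv alpha y) / (2 * sqrt (2 * alpha)).
Proof.
intros Ha Hy; apply is_derive_unique.
exact (is_derive_lift alpha y _ _ Ha Hy (is_derive_h_l _ _ _ _)).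
Qed.

(** Because the two formulas for [h_r] agree to first order at [f0 + c], the
    formula of [h_r1] also gives the derivative at that point. *)
Lemma dH_r_slope_inner (alpha delta lambda y c : R) :
  0 < alpha -> 0 < lambda < alpha * delta -> 0 < y ->
  Psi_inv alpha y <= f0 alpha delta lambda + c ->
  dH_r alpha delta lambda y c
  = lift_slope (sqrt (2 * alpha)) (Psi_inv alpha y)
      (h_r1 alpha delta lambda (Psi_inv alpha y) c)
      (2 * (delta - lambda / alpha) * Psi_inv alpha y - 2 * delta * c)
    / (2 * sqrt (2 * alpha)).
Proof.
intros Ha Hl Hy Hx; apply is_derive_unique.
set (x := Psi_inv alpha y) in *.
replace (h_r1 alpha delta lambda x c) with (h_r alpha delta lambda x c)
  by (unfold h_r; destruct Rle_dec; [reflexivity | lra]).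
apply (is_derive_lift alpha y _ (fun z => h_r alpha delta lambda z c) Ha Hy).
fold x.
destruct Hx as [Hx | Hx].
- apply is_derive_ext_loc with (2 := is_derive_h_r1 alpha delta lambda x c).
  assert (Hd : 0 < f0 alpha delta lambda + c - x) by lra.
  exists (mkposreal _ Hd); intros z Hz.
  apply Rabs_def2 in Hz; simpl in Hz; unfold minus, plus, opp in Hz; simpl in Hz.
  unfold h_r; destruct Rle_dec; [reflexivity | lra].
- assert (Hs : 0 < sqrt (2 * alpha)) by (apply sqrt_lt_R0; lra).
  assert (HB := B0_exp alpha delta lambda Ha).
  assert (HR := f0_root alpha delta lambda Ha Hl).
  unfold h_r.
  apply (is_derive_glue (fun z => z <= f0 alpha delta lambda + c)
           (fun z => Rle_dec z (f0 alpha delta lambda + c))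
           (fun z => h_r1 alpha delta lambda z c)
           (fun z => h_r2 alpha delta lambda z c)).
  + rewrite Hx; unfold h_r1, h_r2.
    replace (- (f0 alpha delta lambda + c - c)) with (- f0 alpha delta lambda)
      by ring.
    rewrite HB, <- HR; ring.
  + apply is_derive_h_r1.
  + evar_last; [apply is_derive_h_r2 |].
    rewrite Hx.
    replace (- (f0 alpha delta lambda + c - c)) with (- f0 alpha delta lambda)
      by ring.
    rewrite HB; field; lra.
Qed.

(** The term in [B0] has disappeared: it contributes a constant to [H_r]. *)
Lemma dH_r_slope_outer (alpha delta lambda y c : R) :
  0 < alpha -> 0 < y -> f0 alpha delta lambda + c < Psi_inv alpha y ->
  dH_r alpha delta lambda y c
  = lift_slope (sqrt (2 * alpha)) (Psi_inv alpha y)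
      (lambda / alpha * c * (c - 2 * Psi_inv alpha y) + c)
      (- (2 * (lambda / alpha) * c))
    / (2 * sqrt (2 * alpha)).
Proof.
intros Ha Hy Hx; apply is_derive_unique.
evar_last.
- eapply (is_derive_lift alpha y _ (fun z => h_r alpha delta lambda z c) Ha Hy).
  apply is_derive_ext_loc
    with (2 := is_derive_h_r2 alpha delta lambda (Psi_inv alpha y) c).
  assert (Hd : 0 < Psi_inv alpha y - (f0 alpha delta lambda + c)) by lra.
  exists (mkposreal _ Hd); intros z Hz.
  apply Rabs_def2 in Hz; simpl in Hz; unfold minus, plus, opp in Hz; simpl in Hz.
  unfold h_r; destruct Rle_dec; [lra | reflexivity].
- unfold h_r; destruct Rle_dec; [lra |].
  unfold lift_slope, h_r2; f_equal; ring.
Qed.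

Lemma slope_l_f0 (alpha delta lambda : R) :
  0 < alpha -> 0 < lambda < alpha * delta ->
  slope_l alpha delta lambda (f0 alpha delta lambda) = 0.
Proof.
intros Ha Hl.
assert (Hs : 0 < sqrt (2 * alpha)) by (apply sqrt_lt_R0; lra).
unfold slope_l, lift_slope, h_l.
rewrite <- (f0_root alpha delta lambda Ha Hl); field; lra.
Qed.

(** Quantitative strict convexity of [H_l] slightly beyond [f0].  The
    margin [1 / s] completes the square in [rho]: the equation for [f0] turns
    [delta - (alpha delta - lambda) (f0 + 1/s)^2] into
    [(delta - lambda / alpha) / 2]. *)
Lemma slope_l_growth (alpha delta lambda : R) :
  0 < alpha -> 0 < lambda < alpha * delta ->
  exists m, 0 < m /\
    forall a b, 0 <= a -> a <= b ->
      b <= f0 alpha delta lambda + / sqrt (2 * alpha) ->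
      m * (b - a) <= slope_l alpha delta lambda b - slope_l alpha delta lambda a.
Proof.
intros Ha Hl.
assert (Hs : 0 < sqrt (2 * alpha)) by (apply sqrt_lt_R0; lra).
assert (Hss : sqrt (2 * alpha) ^ 2 = 2 * alpha) by (apply pow2_sqrt; lra).
assert (HR := f0_root alpha delta lambda Ha Hl).
set (s := sqrt (2 * alpha)) in *; set (f := f0 alpha delta lambda) in *.
set (k := delta - lambda / alpha) in *.
assert (Hk : 0 < k).
{ unfold k; apply Rmult_lt_reg_r with alpha; [lra |].
  replace ((delta - lambda / alpha) * alpha) with (alpha * delta - lambda)
    by (field; lra); lra. }
exists (k * exp (- (s * (f + / s)))).
split; [apply Rmult_lt_0_compat; [lra | apply exp_pos] |].
intros a b H0 Hab Hb.
destruct (MVT_gen (slope_l alpha delta lambda) a b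
  (fun x => exp (- (s * x)) * (2 * (delta - alpha * k * x ^ 2))))
  as (x & Hx & Ex).
- intros x _; unfold slope_l, lift_slope, h_l; fold s k.
  auto_derive; [easy |].
  apply Rminus_diag_uniq.
  transitivity (exp (- (s * x)) * ((2 * alpha - s ^ 2)
    * (k * x ^ 2 - lambda / alpha ^ 2))).
  { unfold k; field; lra. }
  rewrite Hss; ring.
- intros x _; apply continuity_pt_filterlim.
  unfold slope_l, lift_slope, h_l.
  apply (ex_derive_continuous (fun x => exp (- (sqrt (2 * alpha) * x)) *
   (2 * (delta - lambda / alpha) * x +
    sqrt (2 * alpha) * ((delta - lambda / alpha) * x ^ 2 - lambda / alpha ^ 2)))).
  now auto_derive.
- rewrite Rmin_left, Rmax_right in Hx by lra.
  rewrite Ex; apply Rmult_le_compat_r; [lra |].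
  rewrite Rmult_comm; apply Rmult_le_compat.
  + apply Rlt_le, exp_pos.
  + lra.
  + destruct (Req_dec x (f + / s)) as [-> | Hn]; [lra |].
    apply Rlt_le, exp_increasing, Ropp_lt_contravar, Rmult_lt_compat_l; lra.
  + assert (Hsq : x ^ 2 <= (f + / s) ^ 2) by (apply pow_incr; lra).
    assert (Hm : delta - alpha * k * (f + / s) ^ 2 = k / 2).
    { transitivity (delta - alpha * (k * f ^ 2 + 2 * k * f / s) - alpha * k / s ^ 2).
      { field; lra. }
      rewrite HR, Hss; unfold k; field; lra. }
    assert (Hak : 0 < alpha * k) by (apply Rmult_lt_0_compat; lra).
    apply Rmult_le_compat_l with (r := alpha * k) in Hsq; lra.
Qed.

(** The [O(c)] terms grow linearly in [x], but the weight [exp (- s x)] makes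
    them uniformly bounded, since [exp (- t) * (1 + t) <= 1]. *)
Lemma exp_weight_bound (s x a w : R) :
  0 <= a -> w <= 2 * a * (1 + s * x) -> exp (- (s * x)) * w <= 2 * a.
Proof.
intros Ha Hw.
assert (Hp := exp_pos (- (s * x))).
assert (Ht := exp_ineq1_le (s * x)).
assert (Hi : exp (- (s * x)) * exp (s * x) = 1).
{ rewrite <- exp_plus, Rplus_opp_l; apply exp_0. }
apply Rmult_le_compat_l with (r := exp (- (s * x))) in Hw; [| lra].
apply Rmult_le_compat_l with (r := exp (- (s * x))) in Ht; [| lra].
rewrite Hi in Ht.
apply Rmult_le_compat_l with (r := 2 * a) in Ht; [| lra].
lra.
Qed.

(** * Convergence of the tangency points *)

(** Since the slope of [H_l] grows at a rate bounded below, equal slopes force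
    the two abscissae together, and the zero of [h_r1 - h_l], which is
    [1/(2 delta) + c/2], lies between them. *)
Lemma abscissae_close (alpha delta lambda : R) :
  0 < alpha -> 0 < delta -> 0 < lambda < alpha * delta ->
  1 / (2 * delta) < f0 alpha delta lambda ->
  exists L c0, 0 < c0 /\
    forall c y1 y2, 0 < c < c0 -> 1 < y1 -> 1 < y2 ->
      Psi_inv alpha y1 <= 1 / (2 * delta) + c / 2 <= Psi_inv alpha y2 ->
      dH_l alpha delta lambda y1 = dH_r alpha delta lambda y2 c ->
      Rabs (Psi_inv alpha y1 - 1 / (2 * delta)) <= L * c /\
      Rabs (Psi_inv alpha y2 - 1 / (2 * delta)) <= L * c.
Proof.
intros Ha Hd Hl Hdf.
destruct (slope_l_growth alpha delta lambda Ha Hl) as (m & Hm & Hgrow).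
assert (Hs : 0 < sqrt (2 * alpha)) by (apply sqrt_lt_R0; lra).
assert (Hf := slope_l_f0 alpha delta lambda Ha Hl).
assert (His : 0 < / sqrt (2 * alpha)) by now apply Rinv_0_lt_compat.
assert (Hpos : forall y, 1 < y -> 0 < Psi_inv alpha y).
{ intros y Hy; apply Rdiv_lt_0_compat; [rewrite <- ln_1; apply ln_increasing |]; lra. }
set (s := sqrt (2 * alpha)) in *; set (f := f0 alpha delta lambda) in *.
set (d := 1 / (2 * delta)) in *.
assert (Hd0 : 0 < d) by (apply Rdiv_lt_0_compat; lra).
assert (Hla : 0 < lambda / alpha < delta).
{ split; [apply Rdiv_lt_0_compat; lra |].
  apply Rmult_lt_reg_r with alpha; [lra |].
  replace (lambda / alpha * alpha) with lambda by (field; lra); lra. }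
(* [c < c0] puts [f + c] in the range where the growth estimate holds and
   contradicts [m * (f - d - c / 2) <= 2 * delta * c]. *)
exists (2 * delta / m + 1), (Rmin (/ s) (m * (f - d) / (2 * delta + m))).
split.
{ apply Rmin_pos; [lra |].
  apply Rdiv_lt_0_compat; [apply Rmult_lt_0_compat |]; lra. }
intros c y1 y2 [Hc Hc0] Hy1 Hy2 [Hx1 Hx2] Heq.
assert (Hcs := Rlt_le_trans _ _ _ Hc0 (Rmin_l _ _)).
assert (Hcm := Rlt_le_trans _ _ _ Hc0 (Rmin_r _ _)).
apply Rmult_lt_compat_r with (r := 2 * delta + m) in Hcm; [| lra].
replace (m * (f - d) / (2 * delta + m) * (2 * delta + m)) with (m * (f - d))
  in Hcm by (field; lra).
assert (Hp1 := Hpos _ Hy1); assert (Hp2 := Hpos _ Hy2).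
rewrite dH_l_slope in Heq by lra.
destruct (Rle_dec (Psi_inv alpha y2) (f + c)) as [Hin | Hout].
- rewrite dH_r_slope_inner in Heq by (fold f; lra).
  set (x1 := Psi_inv alpha y1) in *; set (x2 := Psi_inv alpha y2) in *.
  fold s in Heq.
  apply Rmult_eq_reg_r in Heq; [| apply Rinv_neq_0_compat; lra].
  assert (Hg := Hgrow x1 x2 ltac:(lra) ltac:(lra) ltac:(lra)).
  assert (Hw : slope_l alpha delta lambda x2 - slope_l alpha delta lambda x1
               <= 2 * (delta * c)).
  { rewrite Heq; unfold slope_l, lift_slope; fold s.
    rewrite <- Rmult_minus_distr_l.
    apply exp_weight_bound; [nra |].
    unfold h_r1, h_l.
    assert (0 < s * c) by nra.
    assert (0 < s * c * (delta * c)) by (repeat apply Rmult_lt_0_compat; lra).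
    lra. }
  assert (Hb : x2 - x1 <= 2 * delta / m * c).
  { apply Rmult_le_reg_l with m; [lra |].
    replace (m * (2 * delta / m * c)) with (2 * (delta * c)) by (field; lra).
    lra. }
  split; apply Rabs_le; lra.
- exfalso.
  rewrite dH_r_slope_outer in Heq by (fold f; lra).
  set (x1 := Psi_inv alpha y1) in *; set (x2 := Psi_inv alpha y2) in *.
  fold s in Heq.
  apply Rmult_eq_reg_r in Heq; [| apply Rinv_neq_0_compat; lra].
  assert (Hdc : 0 < delta * c) by nra.
  assert (Hmc : m * (f - d - c / 2) > 2 * (delta * c)) by nra.
  assert (Hcf : c / 2 < f - d).
  { apply Rmult_lt_reg_l with m; [lra |]; lra. }
  assert (Hg := Hgrow x1 f ltac:(lra) ltac:(lra) ltac:(lra)).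
  assert (Hw : - slope_l alpha delta lambda x1 <= 2 * (lambda / alpha * c)).
  { rewrite Heq; unfold lift_slope; rewrite Ropp_mult_distr_r.
    assert (0 < s * c) by nra.
    assert (0 < lambda / alpha * c) by nra.
    apply exp_weight_bound; [lra |].
    assert (0 < s * c * (lambda / alpha * c)) by (apply Rmult_lt_0_compat; lra).
    lra. }
  assert (lambda / alpha * c <= delta * c) by nra.
  assert (m * (f - d - c / 2) <= m * (f - x1)) by (apply Rmult_le_compat_l; lra).
  lra.
Qed.

Lemma filterlim_at_right_0_of_linear_bound (u : R -> R) (l L c0 : R) :
  0 < c0 -> (forall c, 0 < c < c0 -> Rabs (u c - l) <= L * c) ->
  filterlim u (at_right 0) (locally l).
Proof.
intros Hc0 Hu; apply filterlim_locally; intros eps.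
assert (HL : 0 < Rabs L + 1) by (assert (H := Rabs_pos L); lra).
assert (Hr : 0 < Rmin c0 (eps / (Rabs L + 1))).
{ apply Rmin_pos; [lra | apply Rdiv_lt_0_compat; [apply cond_pos | lra]]. }
exists (mkposreal _ Hr); intros c Hc Hpos.
apply Rabs_def2 in Hc; simpl in Hc; unfold minus, plus, opp in Hc; simpl in Hc.
assert (H1 := Rmin_l c0 (eps / (Rabs L + 1))).
assert (H2 := Rmin_r c0 (eps / (Rabs L + 1))).
apply Rle_lt_trans with (1 := Hu c ltac:(lra)).
apply Rle_lt_trans with ((Rabs L + 1) * c).
- apply Rmult_le_compat_r; [lra |]; assert (H := Rle_abs L); lra.
- replace (pos eps) with ((Rabs L + 1) * (eps / (Rabs L + 1))) by (field; lra).
  apply Rmult_lt_compat_l; lra.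
Qed.

Lemma filterlim_of_Psi_inv_bound (alpha x L c0 : R) (y : R -> R) :
  0 < alpha -> 0 < c0 ->
  (forall c, 0 < c < c0 -> 0 < y c /\ Rabs (Psi_inv alpha (y c) - x) <= L * c) ->
  filterlim y (at_right 0) (locally (Psi alpha x)).
Proof.
intros Ha Hc0 Hy.
apply filterlim_ext_loc with (fun c => Psi alpha (Psi_inv alpha (y c))).
- exists (mkposreal _ Hc0); intros c Hc Hpos.
  apply Rabs_def2 in Hc; simpl in Hc; unfold minus, plus, opp in Hc; simpl in Hc.
  apply Psi_Psi_inv, Hy; lra.
- apply filterlim_comp with (locally x).
  + apply filterlim_at_right_0_of_linear_bound with L c0; [lra |].
    intros c Hc; now apply Hy.
  + apply (ex_derive_continuous (Psi alpha)); unfold Psi; now auto_derive.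
Qed.

Theorem proposition1
  (alpha delta lambda : R)
  (Halpha : 0 < alpha) (Hdelta : 0 < delta)
  (Hlambda : 0 < lambda < alpha * delta)
  (Hf0 : f0 alpha delta lambda > alpha / (2 * lambda))
  (y_v : R -> R)
  (Hy_v : forall c, 0 < c -> is_y_v alpha delta lambda c (y_v c))
  (c1 : R) (Hc1 : admissible_c1 alpha delta lambda y_v c1)
  (y1 y2 : R -> R)
  (Hy : forall c, 0 < c < c1 ->
     tangency_couple alpha delta lambda (y_v c) c (y1 c) (y2 c)) :
  filterlim y1 (at_right 0) (locally (Psi alpha (1 / (2 * delta)))) /\
  filterlim y2 (at_right 0) (locally (Psi alpha (1 / (2 * delta)))).
Proof.
destruct (abscissae_close alpha delta lambda Halpha Hdelta Hlambda
  (inv_2delta_lt_f0 _ _ _ Halpha Hlambda Hf0)) as (L & c0 & Hc0 & HL).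
destruct Hc1 as [Hc1 _].
assert (Hs : 0 < sqrt (2 * alpha)) by (apply sqrt_lt_R0; lra).
assert (Hmono : forall a b, 0 < a -> a < b -> Psi_inv alpha a <= Psi_inv alpha b).
{ intros a b H0 Hab; apply Rmult_le_compat_r.
  - apply Rlt_le, Rinv_0_lt_compat; lra.
  - apply Rlt_le, ln_increasing; lra. }
assert (Hmin : 0 < Rmin c0 c1) by now apply Rmin_pos.
assert (Hall : forall c, 0 < c < Rmin c0 c1 ->
  (0 < y1 c /\ Rabs (Psi_inv alpha (y1 c) - 1 / (2 * delta)) <= L * c) /\
  (0 < y2 c /\ Rabs (Psi_inv alpha (y2 c) - 1 / (2 * delta)) <= L * c)).
{ intros c [Hc Hcm].
  assert (Hl := Rlt_le_trans _ _ _ Hcm (Rmin_l _ _)).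
  assert (Hr := Rlt_le_trans _ _ _ Hcm (Rmin_r _ _)).
  destruct (Hy c (conj Hc Hr)) as (H1 & H2 & H3 & H4 & H5 & _).
  assert (Hyc : Psi_inv alpha (y_c alpha delta c) = 1 / (2 * delta) + c / 2)
    by now apply Psi_inv_Psi.
  destruct (HL c (y1 c) (y2 c) (conj Hc Hl) H1 ltac:(lra)) as [B1 B2].
  - rewrite <- Hyc; split; apply Hmono; lra.
  - exact H5.
  - repeat split; try assumption; lra. }
split; apply filterlim_of_Psi_inv_bound with L (Rmin c0 c1); try assumption;
  intros c Hc; now apply Hall.
Qed.
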